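(* Let $\Omega\subseteq\mathbb{R}^n$ be open, and let $\mathbb{I}=(I,\le,\mathcal{I})$ be a set of indices which, together with $\mathcal{J}\subseteq\mathcal{I}$, a map $\varepsilon\mapsto\underline\varepsilon$ and a map $\varepsilon\mapsto\Omega_\varepsilon$, satisfies assumptions (A1)–(A4) of the context. Let $u\in\mathcal{G}^{\mathbb{I}}(\Omega)$. Then: (i) if $x\in\widetilde{\Omega}_c^{\mathbb{I}}$, then $u(x)$ is a well-defined element of $\widetilde{\mathbb{R}}^{\mathbb{I}}$; (ii) $u=0$ in $\mathcal{G}^{\mathbb{I}}(\Omega)$ if and only if $u(x)=0$ in $\widetilde{\mathbb{R}}^{\mathbb{I}}$ for all $x\in\widetilde{\Omega}_c^{\mathbb{I}}$.
   Context: $\mathbb{N}=\{0,1,2,\dots\}$; $K\Subset\Omega$ means that $K$ is a compact subset of $\Omega$. Set of indices: $\mathbb{I}=(I,\le,\mathcal{I})$ is a set of indices if $(I,\le)$ is a non-empty pre-ordered set (reflexive and transitive relation); $\mathcal{I}$ is a set of subsets of $I$ with $\emptyset\notin\mathcal{I}$ and $I\in\mathcal{I}$; for all $A,B\in\mathcal{I}$ there is $C\in\mathcal{I}$ with $C\subseteq A\cap B$; and, writing $A_{\le e}:=\{\varepsilon\in A\mid\varepsilon\le e\}$ and $\varepsilon<e$ for ''$\varepsilon\le e$ and $\varepsilon\ne e$'', whenever $e\le a\in A\in\mathcal{I}$ the set $A_{\le e}$ is non-empty and for all $b,c\in A_{\le e}$ there is $d\in A_{\le e}$ with $d<b$ and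 $d<c$. Big-O: for $a\in A\in\mathcal{I}$ and nets $(x_\varepsilon),(y_\varepsilon)$ indexed by $I$, $x_\varepsilon=O_{a,A}(y_\varepsilon)$ means $\exists H\in\mathbb{R}_{>0}\,\exists\varepsilon_0\in A_{\le a}\,\forall\varepsilon\in A_{\le\varepsilon_0}:\ |x_\varepsilon|\le H|y_\varepsilon|$. For $\mathcal{J}\subseteq\mathcal{I}$, $x_\varepsilon=O_{\mathcal{J}}(y_\varepsilon)$ means $\exists A\in\mathcal{J}\,\forall a\in A:\ x_\varepsilon=O_{a,A}(y_\varepsilon)$; and $O:=O_{\mathcal{I}}$. A sequence $(z_k)_{k\in\mathbb{N}}$ of $A_{\le a}$ tends to $\emptyset$ in $A_{\le a}$ if $\forall\varepsilon_0\in A_{\le a}\,\exists K\in\mathbb{N}\,\forall k\ge K:\ z_k<\varepsilon_0$. Assumptions: (A1) For each $a\in A\in\mathcal{I}$ there exists a sequence of $A_{\le a}$ which tends to $\emptyset$ in $A_{\le a}$; moreover, for all $b,c\in A_{\le a}$, $b<c$ or $c\le b$. (A2) $\mathcal{J}\subseteq\mathcal{I}$ is non-empty and for all $A,B\in\mathcal{J}$ there is $C\in\mathcal{J}$ with $C\subseteq A\cap B$. (A3) There is a map $I\to(0,1]$, $\varepsilon\mapsto\underline\varepsilon$, such that $\exists A\in\mathcal{I}\,\forall a\in A:\ \lim_{\varepsilon\in A_{\le a}}\underline\varepsilon=0$ (limit along the downward directed set $A_{\le a}$). (A4) A map $\varepsilon\mapsto\Omega_\varepsilon$ is given, where $\Omega_\varepsilon$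 is an open subset of $\mathbb{R}^n$ for each $\varepsilon\in I$. Generalized functions: $\mathcal{E}^{\mathbb{I}}(\Omega)$ is the set of families $u=(u_\varepsilon)_{\varepsilon\in I}$ with $u_\varepsilon\in\mathcal{C}^\infty(\Omega_\varepsilon,\mathbb{R})$ for all $\varepsilon\in I$. $u\in\mathcal{E}_M^{\mathbb{I}}(\Omega)$ iff $u\in\mathcal{E}^{\mathbb{I}}(\Omega)$ and $\forall K\Subset\Omega\,\forall\alpha\in\mathbb{N}^n\,\exists N\in\mathbb{N}:\ \sup_{x\in K}|\partial^\alpha u_\varepsilon(x)|=O_{\mathcal{J}}(\underline\varepsilon^{-N})$. If $u\in\mathcal{E}_M^{\mathbb{I}}(\Omega)$, then $u\in\mathcal{N}^{\mathbb{I}}(\Omega)$ iff $\forall K\Subset\Omega\,\forall m\in\mathbb{N}:\ \sup_{x\in K}|u_\varepsilon(x)|=O(\underline\varepsilon^{m})$. $\mathcal{G}^{\mathbb{I}}(\Omega):=\mathcal{E}_M^{\mathbb{I}}(\Omega)/\mathcal{N}^{\mathbb{I}}(\Omega)$. Generalized points: $\Omega_M^{\mathbb{I}}:=\{(x_\varepsilon)\in\Omega^I\mid\exists N\in\mathbb{N}:\ x_\varepsilon=O_{\mathcal{J}}(\underline\varepsilon^{-N})\}$; for $(x_\varepsilon),(y_\varepsilon)\in\Omega_M^{\mathbb{I}}$, $(x_\varepsilon)\sim_{\mathbb{I}}(y_\varepsilon)$ iff $\forall m\in\mathbb{N}:\ x_\varepsilon-y_\varepsilon=O(\underline\varepsilon^{m})$;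 $\widetilde\Omega^{\mathbb{I}}:=\Omega_M^{\mathbb{I}}/\sim_{\mathbb{I}}$. $\widetilde{\mathbb{R}}^{\mathbb{I}}$ is the same construction with $\mathbb{R}$ in place of $\Omega$. For a property $\mathcal{P}(\varepsilon)$, $\forall^{\mathbb{I}}\varepsilon:\mathcal{P}(\varepsilon)$ (''for $\varepsilon\in\mathbb{I}$ sufficiently small $\mathcal{P}(\varepsilon)$ holds'') means $\exists A\in\mathcal{I}\,\forall a\in A\,\exists\varepsilon_0\le a\,\forall\varepsilon\in A_{\le\varepsilon_0}:\ \mathcal{P}(\varepsilon)$. $[x_\varepsilon]\in\widetilde\Omega_c^{\mathbb{I}}$ iff $[x_\varepsilon]\in\widetilde\Omega^{\mathbb{I}}$ and $\exists K\Subset\Omega\,\forall^{\mathbb{I}}\varepsilon:\ x_\varepsilon\in K$. For $u=[u_\varepsilon]\in\mathcal{G}^{\mathbb{I}}(\Omega)$ and $x=[x_\varepsilon]\in\widetilde\Omega_c^{\mathbb{I}}$, $u(x):=[u_\varepsilon(x_\varepsilon)]$.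
   Formalization: In (i), (u_ε(x_ε)) may fail to be O_J-moderate for some representatives of x, so [u_ε(x_ε)] means the moderate nets ~ to it; for each u_ε some (x_ε) gives a moderate net. Moderateness of u includes K ⊆ Ω_ε for small ε along some A in J. *)

(* Defs.v *)
(* MathComp / MathComp-Analysis *)
From HB Require Import structures.
From mathcomp Require Import all_boot all_order all_algebra.
From mathcomp Require Import all_classical all_reals all_analysis.

Set Implicit Arguments.
Unset Strict Implicit.
Unset Printing Implicit Defensive.

Import Order.TTheory GRing.Theory Num.Theory.
Import numFieldNormedType.Exports.
Local Open Scope classical_set_scope.
Local Open Scope ring_scope.

Section SetOfIndices.
Context {T : Type} (le : T -> T -> Prop).

(* [le] is only a pre-order: this is not the asymmetric part of [le]. *)
Definition strict (x y : T) : Prop := le x y /\ x <> y.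

Definition below (A : set T) (e : T) : set T := [set x | A x /\ le x e].

Definition down_directed (A : set T) (e : T) : Prop :=
  below A e !=set0 /\
  forall b c, below A e b -> below A e c ->
    exists d, [/\ below A e d, strict d b & strict d c].

Definition meet_based (F : set (set T)) : Prop :=
  forall A B, F A -> F B -> exists2 C, F C & C `<=` A `&` B.

End SetOfIndices.

Record index_set := IndexSet {
  idx :> Type;
  ile : idx -> idx -> Prop;
  ifam : set (set idx);
  idx_inhabited : inhabited idx;
  ile_refl : forall x, ile x x;
  ile_trans : forall x y z, ile x y -> ile y z -> ile x z;
  ifam_nonempty : ~ ifam set0;
  ifam_full : ifam setT;
  ifam_meet : meet_based ifam;
  ifam_directed : forall (e a : idx) (A : set idx),
    ile e a -> A a -> ifam A -> down_directed ile A e }.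

Section Asymptotics.
Context {R : realType} {I : index_set}.
Implicit Types (A : set I) (F : set (set I)) (a e : I).

Definition tends_to_empty A a (z : nat -> I) : Prop :=
  (forall k, below (@ile I) A a (z k)) /\
  forall e0, below (@ile I) A a e0 ->
    exists K : nat, forall k : nat, (K <= k)%N -> strict (@ile I) (z k) e0.

Definition down_filter A a : set_system I :=
  filter_from (below (@ile I) A a) (below (@ile I) A).

Definition netO_at {V : normedZmodType R} a A (x : I -> V) (y : I -> R) : Prop :=
  exists H : R, 0 < H /\
  exists2 e0, below (@ile I) A a e0 &
    forall e, below (@ile I) A e0 e -> `|x e| <= H * `|y e|.

Definition netO {V : normedZmodType R} F (x : I -> V) (y : I -> R) : Prop :=
  exists2 A, F A & forall a, A a -> netO_at a A x y.

(* For [F := ifam I] this is "for all sufficiently small e". *)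
Definition forall_small F (P : I -> Prop) : Prop :=
  exists2 A, F A & forall a, A a ->
    exists2 e0, ile e0 a & forall e, below (@ile I) A e0 e -> P e.

End Asymptotics.

Section Assumptions.
Context {R : realType} (I : index_set).

Definition assumption_A1 : Prop :=
  forall (A : set I) (a : I), ifam A -> A a ->
    (exists z : nat -> I, tends_to_empty A a z) /\
    (forall b c, below (@ile I) A a b -> below (@ile I) A a c ->
       strict (@ile I) b c \/ ile c b).

Definition assumption_A2 (J : set (set I)) : Prop :=
  [/\ J `<=` @ifam I, J !=set0 & meet_based J].

Definition assumption_A3 (s : I -> R) : Prop :=
  (forall e, 0 < s e <= 1) /\
  exists2 A, ifam A & forall a, A a -> s @ down_filter A a --> (0 : R).

Definition assumption_A4 (n : nat) (Ome : I -> set 'rV[R]_n) : Prop :=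
  forall e, open (Ome e).

End Assumptions.

Section Smooth.
Context {R : realType} {n : nat}.
Implicit Types (f : 'rV[R]_n -> R).

Definition basis_vec (i : 'I_n) : 'rV[R]_n := delta_mx 0 i.

Definition pderivs (s : seq 'I_n) f : 'rV[R]_n -> R :=
  foldr (fun i g => fun x => 'D_(basis_vec i) g x) f s.

Definition mderiv (alpha : 'I_n -> nat) f : 'rV[R]_n -> R :=
  pderivs (flatten [seq nseq (alpha i) i | i <- enum 'I_n]) f.

(* Meant for open [U]: then it only depends on the restriction of [f] to [U]. *)
Definition smooth_on (U : set 'rV[R]_n) f : Prop :=
  forall (s : seq 'I_n) x, U x ->
    {for x, continuous (pderivs s f)} /\
    forall i, derivable (pderivs s f) x (basis_vec i).

(* [sup set0 = 0], so this is 0 for empty [K]. *)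
Definition supnorm (K : set 'rV[R]_n) f : R := sup [set `|f x| | x in K].

End Smooth.

Section GeneralizedPoints.
Context {R : realType} {I : index_set} (J : set (set I)) (s : I -> R).
Context {V : normedZmodType R} (U : set V).

Definition moderate_points : set (I -> V) :=
  [set x | (forall e, U (x e)) /\ exists N : nat, netO J x (fun e => s e ^- N)].

Definition equiv_points (x y : I -> V) : Prop :=
  forall m : nat, netO (@ifam I) (x \- y) (fun e => s e ^+ m).

(* The moderate nets equivalent to [x]; [x] itself need not be moderate. *)
Definition point_class (x : I -> V) : set (I -> V) :=
  [set y | moderate_points y /\ equiv_points y x].

(* A quotient is represented by the set of its equivalence classes. *)
Definition gen_points : set (set (I -> V)) :=
  [set c | exists2 x, moderate_points x & c = point_class x].

End GeneralizedPoints.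

Section GeneralizedNumbers.
Context {R : realType} {I : index_set} (J : set (set I)) (s : I -> R).

Definition moderate_numbers : set (I -> R) := moderate_points J s setT.

Definition number_class (z : I -> R) : set (I -> R) := point_class J s setT z.

Definition gen_numbers : set (set (I -> R)) := gen_points J s setT.

Definition gen_number0 : set (I -> R) := number_class (fun=> 0).

End GeneralizedNumbers.

Section GeneralizedFunctions.
Context {R : realType} {I : index_set} (J : set (set I)) (s : I -> R).
Context {n : nat} (Om : set 'rV[R]_n) (Ome : I -> set 'rV[R]_n).

(* [u e] stands for a function on [Ome e]; its values elsewhere are junk. *)
Definition fun_net : Type := I -> 'rV[R]_n -> R.

Definition smooth_family : set fun_net :=
  [set u | forall e, smooth_on (Ome e) (u e)].

(* The bound on the supremum over [K] presupposes that [u e] is defined on [K]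
   for the indices [e] it is about; the [forall_small] clause says so. *)
Definition moderate_family : set fun_net :=
  [set u | smooth_family u /\
    forall K, compact K -> K `<=` Om ->
      forall_small J (fun e => K `<=` Ome e) /\
      forall alpha : 'I_n -> nat, exists N : nat,
        netO J (fun e => supnorm K (mderiv alpha (u e))) (fun e => s e ^- N)].

Definition negligible_family : set fun_net :=
  [set u | moderate_family u /\
    forall K, compact K -> K `<=` Om ->
      forall m : nat,
        netO (@ifam I) (fun e => supnorm K (u e)) (fun e => s e ^+ m)].

Definition function_class (u : fun_net) : set fun_net :=
  [set v | moderate_family v /\
           negligible_family (fun e x => v e x - u e x)].

Definition gen_functions : set (set fun_net) :=
  [set c | exists2 u, moderate_family u & c = function_class u].

Definition gen_function0 : set fun_net := function_class (fun _ _ => 0).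

Definition compact_gen_points : set (set (I -> 'rV[R]_n)) :=
  [set c | gen_points J s Om c /\
    exists x K, [/\ c x, compact K, K `<=` Om &
      forall_small (@ifam I) (fun e => K (x e))]].

Definition eval_net (u : fun_net) (x : I -> 'rV[R]_n) : I -> R :=
  fun e => u e (x e).

(* The union of the classes of [eval_net u x] over all representatives. That it
   is one such class, the same for all representatives, is the
   well-definedness of the point value. *)
Definition point_value (u : set fun_net) (x : set (I -> 'rV[R]_n)) :
    set (I -> R) :=
  [set z | exists u' x', [/\ u u', x x' & number_class J s (eval_net u' x') z]].

End GeneralizedFunctions.

(* Main.v *)
(* Given x in K (compact) and y ~ x, a compact neighbourhood L of K in Omega
   contains, for small indices, the coordinatewise path from x to y, so the mean
   value theorem bounds |u(x) - u(y)| by a moderate multiple of |x - y|, which is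
   negligible. Moderate bounds hold on a set of J but "x is in K" only on a set
   of the full family, so moderateness of u(x) needs a representative of x
   lying in K at every index. Conversely, evaluating u at points where |u| is
   maximal on K turns u(x) = 0 into negligibility of the supremum over K. *)
Require Import Defs.
From HB Require Import structures.
From mathcomp Require Import all_boot all_order all_algebra.
From mathcomp Require Import all_classical all_reals all_analysis.

Set Implicit Arguments.
Unset Strict Implicit.
Unset Printing Implicit Defensive.

Import Order.TTheory GRing.Theory Num.Theory.
Import numFieldNormedType.Exports.
Local Open Scope classical_set_scope.
Local Open Scope ring_scope.

(** * Compact sets and suprema in the sup norm *)

Section RowVectors.
Context {R : realType} {n : nat}.
Implicit Types (x y v : 'rV[R]_n) (f : 'rV[R]_n -> R) (K L U : set 'rV[R]_n).

Lemma coord_le_norm v i : `|v 0 i| <= `|v|.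
Proof.
rewrite [leRHS]/Num.Def.normr /= mx_normrE; apply/bigmax_geP.
by right; exists (0, i).
Qed.

Lemma norm_le_coords v (M : R) :
  0 <= M -> (forall i, `|v 0 i| <= M) -> `|v| <= M.
Proof.
move=> M0 vM; rewrite [leLHS]/Num.Def.normr /= mx_normrE.
by apply/bigmax_leP; split=> // -[a i] _ /=; rewrite ord1.
Qed.

(** Each point of [K] has a ball inside [U], and the near-covering form of compactness makes one
    radius serve all of [K]. The set [L] is the sum of [K] and a closed ball, compact as the image
    of a compact product under addition. *)
Lemma compact_thickening K U : compact K -> open U -> K `<=` U ->
  exists2 r : R, 0 < r & exists L, [/\ compact L, L `<=` U &
    forall x y, K x -> `|x - y| <= r -> L y].
Proof.
move=> cK oU KU.
have near_U : \forall r \near (0 : R)^'+,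
    K `<=` [set x | forall y, `|x - y| <= r -> U y].
  move/compact_near_coveringP : cK; apply.
  move=> x /KU Ux.
  have /nbhs_ballP[d /= d0 dU] : nbhs x U by exact: open_nbhs_nbhs.
  have d20 : 0 < d / 2 by rewrite divr_gt0.
  exists (ball x (d / 2), [set r | r < d / 2]) => /=.
    by split; [exact: nbhsx_ballx | exact: nbhs_right_lt].
  move=> [x' r] /= [xx' rd] y x'y; apply: dU.
  apply: (@ball_splitr _ _ x'); first exact: ball_sym.
  by rewrite -ball_normE /ball_ /=; apply: le_lt_trans rd.
have [r [r0 KrU]] : exists r : R, 0 < r /\
    K `<=` [set x | forall y, `|x - y| <= r -> U y].
  near (0 : R)^'+ => r; exists r; split; first by near: r; exact: nbhs_right_gt.
  by near: r.
exists r => //.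
exists [set z | exists2 p : 'rV[R]_n * 'rV[R]_n,
          (K `*` closed_ball (0 : 'rV[R]_n) r) p & p.1 + p.2 = z].
split.
- apply: (@continuous_compact _ _ (fun p : 'rV[R]_n * 'rV[R]_n => p.1 + p.2)).
    by apply: continuous_subspaceT; exact: add_continuous.
  apply: compact_setX => //; apply: bounded_closed_compact.
    exists r; split; first exact: num_real.
    move=> M rM y; rewrite closed_ballE // /closed_ball_ /= sub0r normrN => yr.
    exact: le_trans (ltW rM).
  exact: closed_ball_closed.
- move=> _ [[x y] /= [Kx +] <-]; rewrite closed_ballE // /closed_ball_ /= => yr.
  by apply: (KrU _ Kx); rewrite opprD addNKr -sub0r.
- move=> x y Kx xy; exists (x, y - x); last by rewrite addrC subrK.
  by split=> //; rewrite closed_ballE // /closed_ball_ /= sub0r opprB.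
Unshelve. all: by end_near. Qed.

Lemma supnorm_ge K f x : compact K -> (forall y, K y -> {for y, continuous f}) ->
  K x -> `|f x| <= supnorm K f.
Proof.
move=> cK cf Kx; apply: sup_upper_bound; last by exists x.
split; first by exists `|f x|, x.
have cfK : {within K, continuous f}.
  by apply: continuous_in_subspaceT => y /set_mem; exact: cf.
have [M [_ fM]] := compact_bounded (continuous_compact cfK cK).
by exists (M + 1) => _ [y Ky <-]; apply: (fM (M + 1));
  [rewrite ltrDl | exists y].
Qed.

Lemma supnorm_le K f (M : R) :
  0 <= M -> (forall x, K x -> `|f x| <= M) -> supnorm K f <= M.
Proof.
move=> M0 fM; have [->|/set0P [x Kx]] := eqVneq K set0.
  by rewrite /supnorm image_set0 sup0.
by apply: ge_sup => [|_ [y Ky <-]]; [exists `|f x|, x | exact: fM].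
Qed.

Lemma supnorm_ge0 K f : 0 <= supnorm K f.
Proof.
have [->|/set0P [x Kx]] := eqVneq K set0.
  by rewrite /supnorm image_set0 sup0.
have [ub|nub] := pselect (has_ubound [set `|f x| | x in K]).
  apply: (le_trans (normr_ge0 (f x))); apply: sup_upper_bound; last by exists x.
  by split=> //; exists `|f x|, x.
(* An unbounded set of values has [sup] equal to 0 by convention. *)
by rewrite /supnorm sup_out // => -[].
Qed.

Lemma supnormB K f g : compact K ->
  (forall y, K y -> {for y, continuous f}) ->
  (forall y, K y -> {for y, continuous g}) ->
  supnorm K (fun x => f x - g x) <= supnorm K f + supnorm K g.
Proof.
move=> cK cf cg; apply: supnorm_le; first by rewrite addr_ge0 // supnorm_ge0.
move=> x Kx; apply: (le_trans (ler_normB _ _)).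
by apply: lerD; apply: supnorm_ge.
Qed.

Lemma supnorm_attained K f : compact K -> K !=set0 ->
  (forall y, K y -> {for y, continuous f}) ->
  exists2 x, K x & supnorm K f <= `|f x|.
Proof.
move=> cK K0 cf.
have cfK : {within K, continuous (fun x => `|f x|)}.
  apply: continuous_in_subspaceT => y /set_mem /cf fy.
  by apply: continuous_comp => //; exact: norm_continuous.
have [x /set_mem Kx xM] := EVT_max_rV K0 cK cfK.
by exists x => //; apply: supnorm_le => // y Ky; apply: xM; rewrite inE.
Qed.

(** * Mean value estimates from partial derivatives *)

Lemma derivable_along_line f x v (t : R) : derivable f (x + t *: v) v ->
  is_derive t 1 (fun r : R => f (x + r *: v)) ('D_v f (x + t *: v)).
Proof.
(* The restriction to the line and [f] in direction [v] have the same difference quotient, so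
   derivability and the derivative transfer together. *)
have quotE : (fun h : R => h^-1 *: (((fun r : R => f (x + r *: v)) \o shift t)
      (h *: 1) - f (x + t *: v))) =
    (fun h : R => h^-1 *: ((f \o shift (x + t *: v)) (h *: v)
      - f (x + t *: v))).
  by apply/funext => h /=; rewrite scaler1 scalerDl addrCA.
by move=> df; split; rewrite /derivable /derive quotE.
Qed.

Lemma increment_along_line f x v (h M : R) :
  (forall t, `|t| <= `|h| -> derivable f (x + t *: v) v /\
                             `|'D_v f (x + t *: v)| <= M) ->
  `|f (x + h *: v) - f x| <= M * `|h|.
Proof.
move=> dM; set g := fun r : R => f (x + r *: v).
have gE0 : f x = g 0 by rewrite /g scale0r addr0.
(* The mean value theorem wants ordered endpoints; the interval will be [0, h] or [h, 0] according
   to the sign of [h]. *)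
have seg (a b : R) : a <= b -> (forall t, a <= t <= b -> `|t| <= `|h|) ->
    `|g b - g a| <= M * (b - a).
  move=> ab abh.
  have dg t : t \in `[a, b] -> is_derive t 1 g ('D_v f (x + t *: v)).
    rewrite in_itv /= => /abh /dM [df _]; exact: derivable_along_line.
  have [t tab ->] := @MVT_segment _ g (fun t => 'D_v f (x + t *: v)) a b ab
    (fun t tab => dg t (subset_itv_oo_cc tab))
    (derivable_within_continuous
      (fun t tab => @ex_derive _ _ _ _ _ _ _ (dg t tab))).
  rewrite normrM (ger0_norm (_ : 0 <= b - a)) ?subr_ge0 //.
  apply: ler_wpM2r; first by rewrite subr_ge0.
  by move: tab; rewrite in_itv /= => /abh /dM [].
rewrite gE0; have [h0|h0] := leP 0 h.
  rewrite (ger0_norm h0) -{2}(subr0 h); apply: seg => // t /andP[t0 th].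
  by rewrite !ger0_norm.
rewrite distrC (ltr0_norm h0) -(add0r (- h)); apply: seg; first exact: ltW.
by move=> t /andP[ht t0]; rewrite ler0_norm // (ltr0_norm h0) lerN2.
Qed.

(* In the sup norm, the path from [x] to [y] changing one coordinate at a time
   stays in the ball around [x] that contains [y], so partial derivatives
   suffice. *)
Lemma lipschitz_partials L f x y (M : 'I_n -> R) :
  (forall z, `|x - z| <= `|x - y| -> L z) ->
  (forall z i, L z -> derivable f z (basis_vec i) /\
                      `|'D_(basis_vec i) f z| <= M i) ->
  `|f x - f y| <= \sum_i M i * `|x - y|.
Proof.
move=> ballL dM.
(* Coordinates below [k] are already those of [y], so [p 0] is [x] and [p n] is [y]. *)
pose p k : 'rV[R]_n := \row_j (if (j < k)%N then y 0 j else x 0 j).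
have step k : (k <= n)%N ->
    `|f (p k) - f x| <= \sum_(i < n | (i < k)%N) M i * `|x - y|.
  elim: k => [_|k IH kn].
    have -> : p 0%N = x by apply/rowP => j; rewrite mxE.
    by rewrite subrr normr0 big_pred0.
  pose i := Ordinal kn.
  have pS : p k.+1 = p k + (y 0 i - x 0 i) *: basis_vec i.
    apply/rowP => j; rewrite !mxE eqxx /= ltnS.
    have -> : (j == i) = (j == k :> nat) by [].
    case: ltngtP => [_|_|jk]; [by rewrite mulr0 addr0 .. |].
    by rewrite (_ : j = i) ?mulr1; [rewrite addrC subrK|exact: val_inj].
  rewrite (bigD1 i) //=.
  rewrite -(subrKA (f (p k))); apply: (le_trans (ler_normD _ _)).
  apply: lerD; last first.
    apply: (le_trans (IH (ltnW kn))).
    rewrite le_eqVlt; apply/orP; left; apply/eqP; apply: eq_bigl => j.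
    by rewrite ltnS ltn_neqAle andbC.
  (* The point [x] itself lies in [L], and the derivative bound there forces the sign of [M i]. *)
  have M0 : 0 <= M i.
    by apply: (le_trans (normr_ge0 ('D_(basis_vec i) f x))); apply: (dM _ _ _).2;
       apply: ballL; rewrite subrr normr0.
  apply: (@le_trans _ _ (M i * `|y 0 i - x 0 i|)); last first.
    by apply: ler_wpM2l => //; rewrite distrC;
       have := coord_le_norm (x - y) i; rewrite !mxE.
  (* Relative to [x], coordinate [i] moves by at most its final displacement, earlier coordinates
     have moved fully and later ones not at all; hence the sup norm distance stays within that of
     [y]. *)
  rewrite pS; apply: increment_along_line => t th; apply: dM; apply: ballL.
  apply: norm_le_coords => // j; rewrite !mxE eqxx /=.
  have [->|ji] := eqVneq j i.
    rewrite ltnn mulr1 opprD addNKr normrN (le_trans th) // distrC.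
    by have := coord_le_norm (x - y) i; rewrite !mxE.
  rewrite mulr0 addr0; case: ifP => _; last by rewrite subrr normr0.
  by have := coord_le_norm (x - y) j; rewrite !mxE.
have := step n (leqnn n).
have -> : p n = y by apply/rowP => j; rewrite mxE ltn_ord.
by rewrite distrC (eq_bigl xpredT) // => j; rewrite ltn_ord.
Qed.

(** * Iterated partial derivatives and smoothness *)

Lemma mderiv_basis_vec f i z :
  mderiv (fun j => (j == i : nat)) f z = 'D_(basis_vec i) f z.
Proof.
rewrite /mderiv (_ : flatten _ = [:: i]) //.
(* Only the block of [i] is non-empty, and it has length 1; the enumeration meets [i] exactly
   once. *)
have : uniq (enum 'I_n) by exact: enum_uniq.
have : i \in enum 'I_n by rewrite mem_enum.
elim: (enum 'I_n) => //= j l IH; rewrite inE => /predU1P[<-|il] /andP[jl ul].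
  rewrite eqxx /=; congr (_ :: _).
  elim: l jl {IH ul} => //= k l IH; rewrite inE negb_or => /andP[ik il].
  by rewrite eq_sym (negbTE ik) /= IH.
by rewrite (negbTE (_ : j != i)) /= ?IH //; apply: contraNneq jl => ->.
Qed.

Lemma mderiv0 f : mderiv (fun=> 0%N) f = f.
Proof.
rewrite /mderiv (_ : flatten _ = [::]) //.
by elim: (enum 'I_n).
Qed.

Lemma smooth_continuous U f : smooth_on U f ->
  forall x, U x -> {for x, continuous f}.
Proof. by move=> sf x Ux; have [] := sf [::] x Ux. Qed.

Lemma mderiv_continuous U f alpha : smooth_on U f ->
  forall x, U x -> {for x, continuous (mderiv alpha f)}.
Proof. by move=> sf x Ux; exact: (sf _ x Ux).1. Qed.

(** Differentiating once more requires the identity near the point and not merely at it; openness of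
    [U] provides this at each step of the induction. *)
Lemma pderivsB U f g s : open U -> smooth_on U f -> smooth_on U g ->
  {in U, pderivs s (fun x => f x - g x) =1
         (fun x => pderivs s f x - pderivs s g x)}.
Proof.
move=> oU sf sg; elim: s => [x _ //|i s IH x /set_mem Ux] /=.
rewrite -deriveB; [|by have [_] := sf s x Ux|by have [_] := sg s x Ux].
apply: near_eq_derive; near=> z; apply: IH; apply: mem_set.
by near: z; exact: open_nbhs_nbhs.
Unshelve. all: by end_near. Qed.

Lemma smooth_onB U f g : open U -> smooth_on U f -> smooth_on U g ->
  smooth_on U (fun x => f x - g x).
Proof.
move=> oU sf sg s x Ux.
have [cf df] := sf s x Ux; have [cg dg] := sg s x Ux.
have e : \forall z \near x, pderivs s f z - pderivs s g z
    = pderivs s (fun x => f x - g x) z.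
  near=> z; apply/esym; apply: (pderivsB s oU sf sg); apply: mem_set.
  by near: z; exact: open_nbhs_nbhs.
split.
  rewrite /prop_for /continuous_at -(nbhs_singleton e).
  by apply: cvg_trans (near_eq_cvg e) _; exact: cvgB cf cg.
by move=> i; apply: (near_eq_derivable e); exact: derivableB.
Unshelve. all: by end_near. Qed.

End RowVectors.

(** * Asymptotic relations along the filters of an index set *)

Section Asymptotics.
Context {R : realType} {I : index_set}.
Implicit Types (A B C : set I) (F : set (set I)) (a e : I).

Lemma below_nonempty A a e : ifam A -> A a -> ile e a ->
  exists d, below (@ile I) A e d.
Proof. by move=> FA Aa ea; have [] := ifam_directed ea Aa FA. Qed.

(** A threshold [e0] taken from [A] may lie outside [C]; directedness of [C] supplies an index of
    [C] below it, which serves as the new threshold. *)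
Lemma down_filterW A C c : ifam C -> C `<=` A -> C c ->
  down_filter A c `<=` down_filter C c.
Proof.
move=> FC CA Cc P [e0 [Ae0 e0c] e0P].
have [d [Cd de0]] := below_nonempty FC Cc e0c.
exists d; first by split=> //; exact: ile_trans e0c.
move=> e [Ce ed]; apply: e0P; split; first exact: CA.
exact: ile_trans de0.
Qed.

Lemma down_filter_filter A a : ifam A -> A a -> Filter (down_filter A a).
Proof.
move=> FA Aa; apply: filter_from_filter.
  by exists a; split=> //; exact: ile_refl.
move=> b c Ab Ac; have [_ dir] := ifam_directed (ile_refl a) Aa FA.
have [d [Ad [db _] [dc _]]] := dir _ _ Ab Ac.
by exists d => // e [Ae ed]; split; split=> //; exact: ile_trans ed _.
Qed.

(* The constant in [netO_at a A] depends on [a], so [netO] is not of the form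
   "for all small indices": it is a property of each [down_filter A a]. *)
Definition along F (Q : set_system I -> Prop) : Prop :=
  exists2 A, F A & forall a, A a -> Q (down_filter A a).

(** Each hypothesis holds on its own set of [F]. In the premise, [G1] and [G2] stand for the filters
    of these two sets, and [G] for the finer filter of a common subset [C]. *)
Lemma alongI F (Q1 Q2 Q : set_system I -> Prop) :
  F `<=` @ifam I -> meet_based F ->
  (forall G, Filter G -> forall G1 G2, Q1 G1 -> Q2 G2 ->
    G1 `<=` G -> G2 `<=` G -> Q G) ->
  along F Q1 -> along F Q2 -> along F Q.
Proof.
move=> FI Fm Q12 [A FA QA] [B FB QB].
have [C FC CAB] := Fm A B FA FB.
exists C => // c Cc; have [Ac Bc] := CAB _ Cc.
have fC := down_filter_filter (FI _ FC) Cc.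
apply: Q12 (QA c Ac) (QB c Bc) _ _; apply: down_filterW => //; try exact: FI.
  by move=> d /CAB[].
by move=> d /CAB[].
Qed.

Lemma netOE {V : normedZmodType R} F (x : I -> V) (y : I -> R) :
  netO F x y = along F (fun G => exists H : R, 0 < H /\
    G [set e | `|x e| <= H * `|y e|]).
Proof. by []. Qed.

(** The threshold in [forall_small] may lie outside [A], while that of [down_filter] must belong to
    it; directedness gives an element of [A] below the former. *)
Lemma forall_smallE F (P : I -> Prop) : F `<=` @ifam I ->
  forall_small F P <-> along F (fun G => G P).
Proof.
move=> FI; split=> -[A FA hA]; exists A => // a Aa.
  have [e0 e0a e0P] := hA a Aa.
  have [d [Ad de0]] := below_nonempty (FI _ FA) Aa e0a.
  exists d; first by split=> //; exact: ile_trans e0a.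
  by move=> e [Ae ed]; apply: e0P; split=> //; exact: ile_trans de0.
by have [e0 [Ae0 e0a] e0P] := hA a Aa; exists e0.
Qed.

Section Family.
Context {F : set (set I)} (FI : F `<=` @ifam I) (Fm : meet_based F).

Lemma forall_smallS (P Q : I -> Prop) : (forall e, P e -> Q e) ->
  forall_small F P -> forall_small F Q.
Proof.
move=> PQ [A FA hA]; exists A => // a /hA[e0 e0a e0P].
by exists e0 => // e /e0P/PQ.
Qed.

Lemma forall_smallI (P Q : I -> Prop) :
  forall_small F P -> forall_small F Q -> forall_small F (fun e => P e /\ Q e).
Proof.
move=> /(forall_smallE _ FI) hP /(forall_smallE _ FI) hQ.
apply/(forall_smallE _ FI).
by apply: alongI hP hQ => // G fG G1 G2 G1P G2Q G1G G2G; apply: filterI; auto.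
Qed.

Lemma netO_le {V W : normedZmodType R} (x : I -> V) (y : I -> W) (z : I -> R) :
  forall_small F (fun e => `|x e| <= `|y e|) -> netO F y z -> netO F x z.
Proof.
move=> /(forall_smallE _ FI) hxy; rewrite !netOE => hy.
apply: alongI hxy hy => // G fG G1 G2 G1xy [H [H0 G2y]] G1G G2G.
exists H; split=> //; apply: filterS2 (G1G _ G1xy) (G2G _ G2y).
by move=> e /=; exact: le_trans.
Qed.

Lemma netOD {V : normedZmodType R} (x y : I -> V) (z : I -> R) :
  netO F x z -> netO F y z -> netO F (fun e => x e + y e) z.
Proof.
rewrite !netOE => hx hy; apply: alongI hx hy => //.
move=> G fG G1 G2 [H [H0 G1x]] [H' [H'0 G2y]] G1G G2G.
exists (H + H'); split; first exact: addr_gt0.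
apply: filterS2 (G1G _ G1x) (G2G _ G2y) => e /= xe ye.
by rewrite mulrDl (le_trans (ler_normD _ _)) // lerD.
Qed.

Lemma netOM (x y z w : I -> R) :
  netO F x z -> netO F y w -> netO F (fun e => x e * y e) (fun e => z e * w e).
Proof.
rewrite !netOE => hx hy; apply: alongI hx hy => //.
move=> G fG G1 G2 [H [H0 G1x]] [H' [H'0 G2y]] G1G G2G.
exists (H * H'); split; first exact: mulr_gt0.
apply: filterS2 (G1G _ G1x) (G2G _ G2y) => e /= xe ye.
by rewrite !normrM mulrACA ler_pM.
Qed.

Lemma netO_bounded {V : normedZmodType R} (x : I -> V) (y : I -> R) (H : R) :
  F !=set0 -> (forall e, `|x e| <= H * `|y e|) -> netO F x y.
Proof.
(* [H] may be zero or negative, whereas [netO_at] asks for a positive constant. *)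
move=> [A FA] xy; exists A => // a Aa; exists (Num.max H 1).
split; first by rewrite lt_max ltr01 orbT.
exists a; first by split=> //; exact: ile_refl.
by move=> e _; apply: (le_trans (xy e)); rewrite ler_wpM2r // le_max lexx.
Qed.

Lemma netO_sum {V : normedZmodType R} (T : Type) (l : seq T) (x : T -> I -> V)
    (z : I -> R) :
  F !=set0 -> (forall i, netO F (x i) z) -> netO F (fun e => \sum_(i <- l) x i e) z.
Proof.
move=> F0 xz; elim: l => [|i l IH].
  by apply: (netO_bounded (H := 0)) => // e; rewrite big_nil normr0 mul0r.
rewrite (_ : (fun e => _) = (fun e => x i e + \sum_(j <- l) x j e)).
  exact: netOD.
by apply/funext => e; rewrite big_cons.
Qed.

End Family.

Lemma netO_sub {V : normedZmodType R} F (x : I -> V) (y : I -> R) :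
  F `<=` @ifam I -> netO F x y -> netO (@ifam I) x y.
Proof. by move=> FI [A /FI FA xy]; exists A. Qed.

Lemma forall_small_sub F (P : I -> Prop) :
  F `<=` @ifam I -> forall_small F P -> forall_small (@ifam I) P.
Proof. by move=> FI [A /FI FA hP]; exists A. Qed.

Lemma forall_small_ex (P : I -> Prop) :
  forall_small (@ifam I) P -> exists e, P e.
Proof.
move=> [A FA hA].
have [a Aa] : A !=set0.
  by apply/set0P; apply: contraPneq (@ifam_nonempty I) => <-.
have [e0 e0a e0P] := hA a Aa.
by have [d /e0P] := below_nonempty FA Aa e0a; exists d.
Qed.

Lemma ifam_neq0 : @ifam I !=set0.
Proof. by exists setT; exact: ifam_full. Qed.

Lemma netO_small {V : normedZmodType R} (s : I -> R) (x : I -> V) (r : R) :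
  assumption_A3 s -> 0 < r -> netO (@ifam I) x s ->
  forall_small (@ifam I) (fun e => `|x e| <= r).
Proof.
move=> [_ [A FA s0]] r0 xs; apply/forall_smallE => //.
have alongs : along (@ifam I) (fun G => s @ G --> (0 : R)) by exists A.
move: xs; rewrite netOE => xs; apply: alongI alongs xs => //.
  exact: ifam_meet.
move=> G fG G1 G2 s0G1 [H [H0 xG2]] G1G G2G.
have sG : s @ G --> (0 : R) by move=> P /s0G1; exact: G1G.
(* Convergence of [s] is used at tolerance [r / H], which absorbs the big-O constant. *)
have /cvgr0Pnorm_le /(_ _ (divr_gt0 r0 H0)) := sG.
apply: filterS2 (G2G _ xG2) => e /= xe se; apply: (le_trans xe).
by rewrite mulrC -ler_pdivlMr.
Qed.

End Asymptotics.

(** * Equivalence of nets of points and their classes *)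

Section PointClasses.
Context {R : realType} {I : index_set} (J : set (set I)) (s : I -> R).
Context {V : normedZmodType R} (U : set V).
Implicit Types x y z : I -> V.

Lemma equiv_points_refl x : equiv_points s x x.
Proof.
move=> m; apply: (netO_bounded (H := 0)); first exact: ifam_neq0.
by move=> e; rewrite /= subrr normr0 mul0r.
Qed.

Lemma equiv_points_sym x y : equiv_points s x y -> equiv_points s y x.
Proof.
move=> xy m; apply: netO_le (xy m) => //; first exact: ifam_meet.
exists setT; first exact: ifam_full.
by move=> a _; exists a; [exact: ile_refl | move=> e _ /=; rewrite distrC].
Qed.

Lemma equiv_points_trans y x z :
  equiv_points s x y -> equiv_points s y z -> equiv_points s x z.
Proof.
move=> xy yz m; have := netOD (@subset_refl _ _) (@ifam_meet I) (xy m) (yz m).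
by congr (netO _ _ _); apply/funext => e /=; rewrite addrA subrK.
Qed.

Lemma point_class_eq x y :
  equiv_points s x y -> point_class J s U x = point_class J s U y.
Proof.
move=> xy; apply/seteqP; split=> z [Mz] h; split=> //.
  exact: equiv_points_trans h xy.
exact: equiv_points_trans h (equiv_points_sym xy).
Qed.

Lemma point_class_refl x : moderate_points J s U x -> point_class J s U x x.
Proof. by move=> Mx; split=> //; exact: equiv_points_refl. Qed.

Lemma gen_points_equiv c x y :
  gen_points J s U c -> c x -> c y -> equiv_points s x y.
Proof.
move=> [z _ ->] [_ xz] [_ yz].
exact: equiv_points_trans xz (equiv_points_sym yz).
Qed.

End PointClasses.

(** * Moderate and negligible families and their point values *)

Section GeneralizedFunctions.
Context {R : realType} {n : nat} {I : index_set} {J : set (set I)} {s : I -> R}.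
Context {Om : set 'rV[R]_n} {Ome : I -> set 'rV[R]_n}.
Hypotheses (hOm : open Om) (hA2 : assumption_A2 J) (hA3 : assumption_A3 s).
Hypothesis (hA4 : assumption_A4 Ome).
Implicit Types (u v : fun_net (R := R) (I := I) (n := n)).
Implicit Types (x y : I -> 'rV[R]_n) (K : set 'rV[R]_n).

Let JI : J `<=` @ifam I. Proof. by case: hA2. Qed.
Let J0 : J !=set0. Proof. by case: hA2. Qed.
Let Jmeet : meet_based J. Proof. by case: hA2. Qed.
Let s_gt0 e : 0 < s e. Proof. by case: hA3 => /(_ e) /andP[]. Qed.
Let s_le1 e : s e <= 1. Proof. by case: hA3 => /(_ e) /andP[]. Qed.

Lemma moderate_in_compact K x : compact K -> K `<=` Om -> (forall e, K (x e)) ->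
  moderate_points J s Om x.
Proof.
move=> cK KOm Kx; split; first by move=> e; exact: KOm.
have [M [_ KM]] := compact_bounded cK.
exists 0%N; apply: (netO_bounded (H := M + 1)) => // e.
by rewrite expr0 invr1 normr1 mulr1; apply: KM (Kx e); rewrite ltrDl.
Qed.

Lemma compact_gen_points_intro K x :
  compact K -> K `<=` Om -> (forall e, K (x e)) ->
  compact_gen_points J s Om (point_class J s Om x).
Proof.
move=> cK KOm Kx; have Mx := moderate_in_compact cK KOm Kx.
split; first by exists x.
exists x, K; split=> //; first exact: point_class_refl.
exists setT; first exact: ifam_full.
by move=> a _; exists a; [exact: ile_refl | move=> e _; exact: Kx].
Qed.

(** Wherever a representative leaves [K], it is replaced by one fixed value that it takes in [K]. It
    lies in [K] for all small indices, so the change does not affect its equivalence class. *)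
Lemma compact_gen_points_repr c : compact_gen_points J s Om c ->
  exists x K, [/\ c x, compact K, K `<=` Om & forall e, K (x e)].
Proof.
move=> [gc [x [K [cx cK KOm Kx]]]].
have [e0 Ke0] := forall_small_ex Kx.
pose y e := if pselect (K (x e)) then x e else x e0.
have Ky e : K (y e) by rewrite /y; case: pselect.
exists y, K; split=> //; have [z _ cz] := gc; rewrite cz in cx *.
have [_ xz] := cx.
split; first exact: moderate_in_compact Ky.
apply: equiv_points_trans xz => m.
apply: (@netO_le _ _ (@ifam I) _ _ _ _ _ (fun=> 0 : R)) => //.
- exact: ifam_meet.
- apply: forall_smallS Kx => e Kxe.
  have yx : y e = x e by rewrite /y; case: pselect.
  by rewrite /= yx subrr !normr0.
- apply: (netO_bounded (H := 0)); first exact: ifam_neq0.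
  by move=> e; rewrite normr0 mul0r.
Qed.

Lemma moderate_eval K u x : moderate_family J s Om Ome u ->
  compact K -> K `<=` Om -> (forall e, K (x e)) ->
  moderate_numbers J s (eval_net u x).
Proof.
move=> [su mu] cK KOm Kx; split=> //; have [KOme bu] := mu K cK KOm.
have [N uN] := bu (fun=> 0%N); exists N; apply: netO_le uN => //.
apply: forall_smallS KOme => e KOe; rewrite mderiv0 (ger0_norm (supnorm_ge0 _ _)).
by apply: supnorm_ge => // y /KOe; exact: smooth_continuous (su e) _.
Qed.

(** v(x) - u(y) splits into (v - u)(x), negligible on the thickened compact, and u(x) - u(y),
    handled by the mean value estimate. Changes of representative of the function and of the point
    are thus treated together. *)
Lemma eval_equiv K u v x y : moderate_family J s Om Ome u ->
  negligible_family J s Om Ome (fun e z => v e z - u e z) ->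
  compact K -> K `<=` Om -> (forall e, K (y e)) -> equiv_points s x y ->
  equiv_points s (eval_net v x) (eval_net u y).
Proof.
move=> [su mu] [[svu mvu] nvu] cK KOm Ky xy.
have [r r0 [L [cL LOm KL]]] := compact_thickening cK hOm KOm.
have [LOme dL] := mu L cL LOm.
have {}LOme := forall_small_sub JI LOme.
(* Order 1 of the equivalence already brings the distance below [r]. *)
have near_y : forall_small (@ifam I) (fun e => `|(x \- y) e| <= r).
  by apply: netO_small hA3 r0 _; exact: (xy 1%N).
have small := forall_smallI (@subset_refl _ _) (@ifam_meet I) LOme near_y.
move=> m.
rewrite (_ : _ \- _ =
    fun e => (v e (x e) - u e (x e)) + (u e (x e) - u e (y e)));
  last by apply/funext => e; rewrite /= subrKA.
apply: netOD; [by []|exact: ifam_meet| |].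
  apply: netO_le (nvu L cL LOm m) => //; first exact: ifam_meet.
  apply: forall_smallS small => e [LOe xye].
  rewrite (ger0_norm (supnorm_ge0 _ _)).
  apply: (supnorm_ge (f := fun z => v e z - u e z)) => //.
    by move=> z /LOe; exact: smooth_continuous (svu e) _.
  by apply: KL (Ky e) _; rewrite distrC.
(* First-order derivatives are written with a multi-index having a single 1, the form in which
   moderateness bounds them. *)
pose D i e := supnorm L (mderiv (fun j => (j == i : nat)) (u e)).
apply: (@netO_le _ _ (@ifam I) _ _ _ _ _
    (fun e => \sum_i D i e * `|x e - y e|)) => //; first exact: ifam_meet.
  apply: forall_smallS small => e [LOe xye].
  rewrite distrC; apply: le_trans (ler_norm _); rewrite [in leRHS](distrC (x e)).
  apply: (lipschitz_partials (L := L)).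
    move=> z yz; apply: KL (Ky e) _; apply: (le_trans yz).
    by rewrite distrC.
  move=> z i Lz; split; first by have [_] := su e [::] z (LOe _ Lz).
  rewrite -mderiv_basis_vec; apply: supnorm_ge => // t /LOe.
  exact: mderiv_continuous (su e) _.
apply: netO_sum; [by []|exact: ifam_meet|exact: ifam_neq0|] => i.
have [N DN] := dL (fun j => (j == i : nat)).
(* The equivalence is used at order [N + m]: the excess [N] cancels the growth [s e ^- N] of the
   derivative. *)
rewrite (_ : (fun e => s e ^+ m) = (fun e => s e ^- N * s e ^+ (N + m))).
  apply: netOM; [by []|exact: ifam_meet|exact: netO_sub DN|].
  apply: netO_le (xy (N + m)%N) => //; first exact: ifam_meet.
  by apply: forall_smallS small => e _; rewrite normr_id.
by apply/funext => e; rewrite exprD mulKf // expf_neq0 // gt_eqF.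
Qed.

Lemma moderate_familyB u v :
  moderate_family J s Om Ome u -> moderate_family J s Om Ome v ->
  moderate_family J s Om Ome (fun e z => u e z - v e z).
Proof.
move=> [su mu] [sv mv]; split; first by move=> e; exact: smooth_onB.
move=> K cK KOm; have [KOme bu] := mu K cK KOm; have [_ bv] := mv K cK KOm.
split=> // alpha; have [N uN] := bu alpha; have [N' vN'] := bv alpha.
exists (N + N')%N.
(* Both bounds are brought to the exponent [N + N']; raising an exponent weakens the bound because
   [s e <= 1]. *)
have mono (N1 N2 : nat) (f : I -> R) : netO J f (fun e => s e ^- N1) ->
    netO J f (fun e => s e ^- (N1 + N2)).
  move=> fN.
  rewrite (_ : (fun e => _) = (fun e => s e ^- N1 * s e ^- N2)); last first.
    by apply/funext => e; rewrite exprD invfM.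
  rewrite (_ : f = (fun e => f e * 1)); last first.
    by apply/funext => e; rewrite mulr1.
  apply: netOM => //; apply: (netO_bounded (H := 1)) => // e.
  have sN : 0 < s e ^+ N2 by exact: exprn_gt0.
  rewrite mul1r normr1 gtr0_norm ?invr_gt0 // invf_ge1 //.
  by rewrite exprn_ile1 // ltW.
have := mono _ N _ vN'; rewrite addnC => {}vN'.
have := netOD JI Jmeet (mono _ N' _ uN) vN'.
apply: netO_le => //; apply: forall_smallS KOme => e KOe.
rewrite (ger0_norm (supnorm_ge0 _ _)); apply: le_trans (ler_norm _).
apply: le_trans (supnormB cK _ _); last 2 first.
- by move=> y /KOe; exact: mderiv_continuous (su e) _.
- by move=> y /KOe; exact: mderiv_continuous (sv e) _.
(* On [K], inside the open set [Ome e], differentiation commutes with the difference, so both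
   suprema run over the same set of values. *)
rewrite le_eqVlt; apply/orP; left; apply/eqP; congr sup.
apply: eq_imagel => x Kx; congr `|_|.
by rewrite /mderiv (pderivsB _ (@hA4 e) (su e) (sv e)) ?inE; [|exact: KOe].
Qed.

Lemma negligible_familyB u v :
  negligible_family J s Om Ome u -> negligible_family J s Om Ome v ->
  negligible_family J s Om Ome (fun e z => u e z - v e z).
Proof.
move=> [Mu nu] [Mv nv]; split; first exact: moderate_familyB.
move=> K cK KOm m; have [KOme _] := Mu.2 K cK KOm.
have := netOD (@subset_refl _ _) (@ifam_meet I) (nu K cK KOm m) (nv K cK KOm m).
apply: netO_le => //; first exact: ifam_meet.
apply: forall_smallS (forall_small_sub JI KOme) => e KOe.
rewrite (ger0_norm (supnorm_ge0 _ _)); apply: le_trans (ler_norm _).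
by apply: supnormB => // y /KOe;
  [exact: smooth_continuous (Mu.1 e) _|exact: smooth_continuous (Mv.1 e) _].
Qed.

(** Even for the zero net, moderateness demands that compact sets lie in [Ome e] for small indices.
    An existing moderate [u] provides this, the zero net being [u] minus itself. *)
Lemma negligible_family0 u : moderate_family J s Om Ome u ->
  negligible_family J s Om Ome (fun _ _ => 0).
Proof.
move=> Mu; split.
  have := moderate_familyB Mu Mu; congr (moderate_family _ _ _ _ _).
  by apply/funext => e; apply/funext => z; rewrite subrr.
move=> K cK KOm m; apply: (netO_bounded (H := 0)); first exact: ifam_neq0.
move=> e; rewrite mul0r (ger0_norm (supnorm_ge0 _ _)).
by apply: supnorm_le => // x _; rewrite normr0.
Qed.

Lemma function_class_refl u : moderate_family J s Om Ome u ->
  function_class J s Om Ome u u.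
Proof.
move=> Mu; split=> //; have := negligible_family0 Mu.
congr (negligible_family _ _ _ _ _).
by apply/funext => e; apply/funext => z; rewrite subrr.
Qed.

Lemma function_class_eq0 u : moderate_family J s Om Ome u ->
  function_class J s Om Ome u = gen_function0 J s Om Ome <->
  negligible_family J s Om Ome u.
Proof.
have sub0 v : (fun e z => v e z - 0) = v.
  by apply/funext => e; apply/funext => z; rewrite subr0.
move=> Mu; split=> [u0|nu].
  by have := function_class_refl Mu; rewrite u0 => -[_]; rewrite sub0.
have n0 := negligible_family0 Mu.
apply/seteqP; split=> v [Mv]; rewrite ?sub0 => nv; split=> //; rewrite ?sub0.
  (* [v] is recovered as (v - u) - (0 - u), a difference of negligible families. *)
  have := negligible_familyB nv (negligible_familyB n0 nu).
  congr (negligible_family _ _ _ _ _).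
  by apply/funext => e; apply/funext => z; rewrite sub0r opprK subrK.
exact: negligible_familyB nv nu.
Qed.

(** Every pair of representatives evaluates to a net equivalent to [eval_net u x], with [x] valued
    in [K]; the union defining [point_value] therefore collapses to a single class. *)
Lemma point_valueE u u' c x K x' : moderate_family J s Om Ome u ->
  function_class J s Om Ome u u' -> gen_points J s Om c ->
  c x -> compact K -> K `<=` Om -> (forall e, K (x e)) -> c x' ->
  number_class J s (eval_net u' x') =
  point_value J s (function_class J s Om Ome u) c.
Proof.
move=> Mu uu' gc cx cK KOm Kx cx'.
have classE v y : function_class J s Om Ome u v -> c y ->
    number_class J s (eval_net v y) = number_class J s (eval_net u x).
  move=> [_ nv] cy; apply: point_class_eq; apply: eval_equiv Kx _ => //.
  exact: gen_points_equiv gc cy cx.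
apply/seteqP; split=> z; first by move=> hz; exists u', x'.
by move=> [v [y [uv cy hz]]]; rewrite (classE _ _ uu' cx') -(classE _ _ uv cy).
Qed.

(* Test points: at each index, a point of [K] where [|u e|] is maximal. *)
Lemma negligible_of_point_values u : moderate_family J s Om Ome u ->
  (forall c, compact_gen_points J s Om c ->
    point_value J s (function_class J s Om Ome u) c = gen_number0 J s) ->
  negligible_family J s Om Ome u.
Proof.
move=> Mu u0; split=> // K cK KOm m.
have [K0|/set0P Kn0] := eqVneq K set0.
  apply: (netO_bounded (H := 0)); first exact: ifam_neq0.
  by move=> e; rewrite K0 /supnorm image_set0 sup0 normr0 mul0r.
(* Where [K] is not inside [Ome e], an arbitrary point of [K] is taken; the final comparison
   concerns small indices, at which the inclusion holds. *)
have /choice[x xP] : forall e, exists z, K z /\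
    (K `<=` Ome e -> supnorm K (u e) <= `|u e z|).
  move=> e; have [KOe|nKOe] := pselect (K `<=` Ome e); last first.
    by have [x Kx] := Kn0; exists x.
  have [|x Kx ux] := supnorm_attained (f := u e) cK Kn0; last by exists x.
  by move=> y /KOe; exact: smooth_continuous (Mu.1 e) _.
have Kx e : K (x e) by have [] := xP e.
have cgx := compact_gen_points_intro cK KOm Kx.
have cx := point_class_refl (moderate_in_compact cK KOm Kx).
have := u0 _ cgx.
rewrite -(point_valueE Mu (function_class_refl Mu) cgx.1 cx cK KOm Kx cx) => ux0.
(* Being moderate, this net belongs to its own class, which the hypothesis identifies with the class
   of 0; hence it is negligible. *)
have : number_class J s (eval_net u x) (eval_net u x).
  by apply: point_class_refl; exact: moderate_eval Kx.
rewrite ux0 => -[_ /(_ m)]; apply: netO_le => //; first exact: ifam_meet.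
have [KOme _] := Mu.2 K cK KOm.
apply: forall_smallS (forall_small_sub JI KOme) => e KOe /=.
by rewrite subr0 (ger0_norm (supnorm_ge0 _ _)); have [_] := xP e; exact.
Qed.

End GeneralizedFunctions.

Theorem theorem37 (R : realType) (n : nat) (I : index_set) (J : set (set I))
    (s : I -> R) (Om : set 'rV[R]_n) (Ome : I -> set 'rV[R]_n)
    (hOm : open Om)
    (hA1 : assumption_A1 I) (hA2 : assumption_A2 J)
    (hA3 : assumption_A3 s) (hA4 : assumption_A4 Ome)
    (u : set (fun_net (R := R) (I := I) (n := n)))
    (hu : gen_functions J s Om Ome u) :
  (forall x, compact_gen_points J s Om x ->
     [/\ gen_numbers J s (point_value J s u x),
         (forall u' x', u u' -> x x' ->
            number_class J s (eval_net u' x') = point_value J s u x) &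
         (forall u', u u' -> exists2 x', x x' &
            moderate_numbers J s (eval_net u' x'))])
  /\
  (u = gen_function0 J s Om Ome <->
   forall x, compact_gen_points J s Om x ->
     point_value J s u x = gen_number0 J s).
Proof.
have [u0 Mu0 uE] := hu; rewrite {}uE {u hu}; split=> [c cc|].
  have [x [K [cx cK KOm Kx]]] := compact_gen_points_repr hA2 cc.
  have pv u' x' (uu' : function_class J s Om Ome u0 u') (cx' : c x') :=
    point_valueE hOm hA2 hA3 Mu0 uu' cc.1 cx cK KOm Kx cx'.
  have uu0 := function_class_refl hA2 hA3 hA4 Mu0.
  split=> [|u' x' uu' cx'|u' uu'].
  - exists (eval_net u0 x); first exact: (moderate_eval hA2 Mu0 cK KOm Kx).
    by rewrite -(pv _ _ uu0 cx).
  - exact: pv.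
  - by exists x => //; exact: (moderate_eval hA2 uu'.1 cK KOm Kx).
rewrite function_class_eq0 //; split=> [nu0 c cc|]; last first.
  exact: negligible_of_point_values.
have [x [K [cx cK KOm Kx]]] := compact_gen_points_repr hA2 cc.
have /(function_class_eq0 hA2 hA3 hA4 Mu0) u0E := nu0.
(* The zero net represents a vanishing class, and point values may be computed from any
   representative. *)
have u00 : function_class J s Om Ome u0 (fun _ _ => 0).
  rewrite u0E; apply: function_class_refl => //.
  by have [] := negligible_family0 hA2 hA3 hA4 Mu0.
by rewrite -(point_valueE hOm hA2 hA3 Mu0 u00 cc.1 cx cK KOm Kx cx).
Qed.
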